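(* The quantum state tomography problem for an unknown $n$-qubit mixed state $\rho$ with accuracy $\epsilon>0$ can be solved, with success probability at least $1-\delta$, using $$\mathcal{O}\!\left(\frac{10^n\,\log\frac{1}{\delta}}{\epsilon^2}\right)$$ copies of $\rho$ via Pauli measurement on each qubit.
   Context: An $n$-qubit mixed state (density matrix) is a positive semidefinite operator of trace $1$ on $(\mathbb{C}^2)^{\otimes n}$. $\|A\|_1=\operatorname{tr}\sqrt{A^\dagger A}$ is the trace norm. The constant implied by $\mathcal{O}(\cdot)$ is absolute. Quantum state tomography problem: given copies of an unknown $n$-qubit mixed state $\rho$ and a given $\epsilon>0$, output (a classical description of) a density matrix $\sigma$ such that $\|\rho-\sigma\|_1<\epsilon$. Success with probability at least $1-\delta$ means that, for every $\rho$, this inequality holds with probability at least $1-\delta$ over the measurement outcomes. Pauli measurement on each qubit: for each copy of $\rho$, a string $(P_1,\dots,P_n)\in\{\sigma_X,\sigma_Y,\sigma_Z\}^n$ of single-qubit Pauli matrices is chosen, and for each $i$ the $i$-th qubit of that copy is measured in the eigenbasis of $P_i$. The outcome $(s_1,\dots,s_n)\in\{+1,-1\}^n$ occurs with probability $\operatorname{tr}\big(\rho\bigotimes_{i=1}^n \tfrac{I+s_iP_i}{2}\big)$. Copies are measured separately, and the output $\sigma$ is computed classically from the chosen bases and the measurement outcomes.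
   Formalization: log(1/δ) is replaced by log(1/min(δ,1/2)): the bound is literal for δ ≤ 1/2, and for δ in (1/2,1) it is the bound at δ = 1/2, since with an absolute constant the literal bound falls below one copy as δ → 1 and is then false. *)

(* Defs.v *)
From HB Require Import structures.
From mathcomp Require Import all_boot all_order all_algebra.
From mathcomp Require Import complex.
From mathcomp Require Import all_classical all_reals all_analysis.

Set Implicit Arguments.
Unset Strict Implicit.
Unset Printing Implicit Defensive.

Import Order.TTheory GRing.Theory Num.Theory.

Local Open Scope ring_scope.
Local Open Scope sesquilinear_scope.

Section Matrices.
Variable C : numClosedFieldType.

Definition psdmx m (A : 'M[C]_m) : Prop :=
  A \is hermsymmx /\ forall v : 'cV[C]_m, 0 <= (v^t* *m A *m v) 0 0.

Definition density m (rho : 'M[C]_m) : Prop := psdmx rho /\ \tr rho = 1.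

(* Spectral calculus; only meaningful for positive semidefinite A (see
   [sqrtmx_spec]). *)
Definition sqrtmx m (A : 'M[C]_m) : 'M[C]_m :=
  invmx (spectralmx A) *m diag_mx (map_mx sqrtC (spectral_diag A))
    *m spectralmx A.

Lemma hermsymmxE m (A : 'M[C]_m) : (A \is hermsymmx) = (A == A^t*).
Proof. by rewrite is_hermitianmxE expr0 scale1r. Qed.

Lemma sqrtmx_spec m (A : 'M[C]_m) :
  psdmx A -> psdmx (sqrtmx A) /\ sqrtmx A *m sqrtmx A = A.
Proof.
move=> [hA pA]; rewrite /sqrtmx.
have := hermitian_normalmx hA => /orthomx_spectralP.
set P := spectralmx A; set d := spectral_diag A => defA.
have uP : P \is unitarymx by apply: spectral_unitarymx.
have PV : invmx P = P^t* by apply: invmx_unitary.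
have PPV : P *m P^t* = 1%:M by apply/unitarymxP.
have d0 i : 0 <= d 0 i.
  have := pA (P^t* *m delta_mx i 0); rewrite defA PV.
  rewrite trmx_mul map_mxM trmxCK !mulmxA.
  rewrite -[_ *m P *m P^t*]mulmxA PPV mulmx1.
  rewrite -[_ *m P *m P^t*]mulmxA PPV mulmx1.
  rewrite trmx_delta map_delta_mx -rowE row_diag_mx -scalemxAl.
  by rewrite mul_delta_mx !mxE eqxx mulr1.
set e := map_mx sqrtC d.
have e0 i : 0 <= e 0 i by rewrite mxE sqrtC_ge0.
split; last first.
  rewrite [RHS]defA PV !mulmxA -[_ *m P *m P^t*]mulmxA PPV mulmx1.
  rewrite -[P^t* *m _ *m _]mulmxA mulmx_diag; congr (_ *m diag_mx _ *m _).
  by apply/rowP => i; rewrite !mxE -expr2 sqrtCK.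
split.
  rewrite hermsymmxE PV !trmx_mul !map_mxM trmxCK tr_diag_mx map_diag_mx mulmxA.
  apply/eqP; congr (_ *m diag_mx _ *m _).
  by apply/rowP => i; rewrite [RHS]mxE; apply/esym/CrealP/ger0_real.
move=> v; rewrite PV !mulmxA -!mulmxA mulmxA.
have -> : v^t* *m P^t* = (P *m v)^t* by rewrite trmx_mul map_mxM.
rewrite mxE sumr_ge0 // => i _.
rewrite mul_diag_mx !mxE mulrCA mulr_ge0 //; first by have := e0 i; rewrite mxE.
by rewrite mulrC mul_conjC_ge0.
Qed.

End Matrices.

Section PauliTomography.
Variable R : realType.
Local Notation C := R[i].

(* The trace is a nonnegative real, so taking its real part only changes its
   type. *)
Definition tracenorm m (A : 'M[C]_m) : R :=
  complex.Re (\tr (sqrtmx (A^t* *m A))).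

(* (C^2)^{(x) n}: its computational basis is indexed by bit strings, so that
   its dimension is #|{ffun 'I_n -> 'I_2}| = 2 ^ n. *)
Definition qdim n := #|{ffun 'I_n -> 'I_2}|.

Definition qubits n (x : 'I_(qdim n)) : {ffun 'I_n -> 'I_2} := enum_val x.

Definition tensor n (A : 'I_n -> 'M[C]_2) : 'M[C]_(qdim n) :=
  \matrix_(x, y) \prod_(i < n) A i (qubits x i) (qubits y i).

Inductive pauli := PauliX | PauliY | PauliZ.

Definition pauli_mx (P : pauli) : 'M[C]_2 :=
  \matrix_(a, b)
    match P with
    | PauliX => (a != b)%:R
    | PauliY => if a == b then 0 else if a == 0 then - 'i else 'i
    | PauliZ => if a == b then (-1) ^+ a else 0
    end.

(* The outcome s = (-1) ^+ b of a single-qubit measurement is encoded by the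
   boolean b. *)
Definition pauli_proj (P : pauli) (b : bool) : 'M[C]_2 :=
  2^-1 *: (1%:M + (-1) ^+ b *: pauli_mx P).

(* As for [tracenorm], the trace is a nonnegative real when rho is a density
   matrix. *)
Definition outcome_prob n (rho : 'M[C]_(qdim n)) (P : 'I_n -> pauli)
    (s : {ffun 'I_n -> bool}) : R :=
  complex.Re (\tr (rho *m tensor (fun i => pauli_proj (P i) (s i)))).

(* A tomography scheme for N copies: the basis of each qubit of each copy is
   fixed beforehand, and the output is a function of all the outcomes. *)
Record pauli_scheme n N := PauliScheme {
  basis : 'I_N -> 'I_n -> pauli;
  output : {ffun 'I_N -> {ffun 'I_n -> bool}} -> 'M[C]_(qdim n);
  output_density : forall s, density (output s)
}.

(* The copies are measured separately, hence the product distribution. *)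
Definition success_prob n N (S : pauli_scheme n N) (eps : R)
    (rho : 'M[C]_(qdim n)) : R :=
  \sum_(s | tracenorm (rho - output S s) < eps)
    \prod_(k < N) outcome_prob rho (basis S k) (s k).

Definition solves_tomography n N (S : pauli_scheme n N) (eps delta : R) : Prop :=
  forall rho : 'M[C]_(qdim n), density rho ->
    1 - delta <= success_prob S eps rho.

End PauliTomography.

(* Main.v *)
(* Measure every Pauli setting equally often.  If a copy measured in the bases P
   gives the outcome s, its "shadow" is the tensor product of the matrices
   3 Pi_i - 1, where Pi_i is the observed single-qubit projector.  Averaged over
   all settings its expectation is rho, and its squared Frobenius norm is exactly
   5^n: each factor has the eigenvalues 2 and -1.

   A dimension-free Hoeffding bound for sums of independent centred vectors
   (the exponential moment of |S|^2 / c is controlled by conditioning on one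
   summand at a time) shows that the mean of N shadows is within t of rho in
   squared Frobenius norm, except with probability e * exp(- N t / (64 * 5^n)).
   Outputting any density matrix that close to the mean and using
   |A|_1^2 <= 2^n |A|_F^2, so that t = eps^2 / (4 * 2^n), gives the rate 10^n.

   Rounding N up to a multiple of 3^n costs at most 3^n <= 5^n, which is within
   the bound when eps^2 <= 4 * 2^n; for larger eps no copy is needed, because two
   density matrices are at squared Frobenius distance at most 4. *)
Require Import Defs.
From mathcomp Require Import all_boot all_order all_algebra.
From mathcomp Require Import all_classical all_reals all_analysis.
From mathcomp Require Import complex ring lra.

Set Implicit Arguments.
Unset Strict Implicit.
Unset Printing Implicit Defensive.

Import Order.TTheory GRing.Theory Num.Theory.
Local Open Scope ring_scope.

(** * Elementary inequalities and sums over finite functions *)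

(** For [x >= 1 / 2], already [x <= 2 * x ^+ 2]. Below [1 / 2], [expR x] is at most [(1 - x)^-1],
    hence at most [1 + x + 2 * x ^+ 2]. *)
Lemma expR_le_add_sqr (R : realType) (x : R) : expR x <= x + expR (2 * x ^+ 2).
Proof.
have inv_bound (y : R) : y < 1 -> expR y <= (1 - y)^-1.
  move=> y1; rewrite -[y in expR y]opprK expRN lef_pV2 ?posrE ?expR_gt0 ?subr_gt0 //.
  exact: expR_ge1Dx.
have [x2|x2] := lerP (1 / 2) x.
  have : expR x <= expR (2 * x ^+ 2) by rewrite ler_expR; nra.
  lra.
apply: (@le_trans _ _ (x + (1 + 2 * x ^+ 2))); last by rewrite lerD2l expR_ge1Dx.
apply: (le_trans (inv_bound x _)); first by lra.
rewrite -[leLHS]mul1r ler_pdivrMr; last by lra.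
have [x0|x0] := lerP 0 x; nra.
Qed.

(** Lagrange's identity writes twice the defect as a sum of squares. *)
Lemma cauchy_schwarz_sum (R : realType) (J : finType) (u v : J -> R) :
  (\sum_j u j * v j) ^+ 2 <= (\sum_j u j ^+ 2) * (\sum_j v j ^+ 2).
Proof.
have : 0 <= \sum_i \sum_j (u i * v j - u j * v i) ^+ 2.
  by apply: sumr_ge0 => i _; apply: sumr_ge0 => j _; apply: sqr_ge0.
have -> : \sum_i \sum_j (u i * v j - u j * v i) ^+ 2 =
   2 * ((\sum_j u j ^+ 2) * (\sum_j v j ^+ 2)) - 2 * (\sum_j u j * v j) ^+ 2.
  transitivity (\sum_i \sum_j (u i ^+ 2 * v j ^+ 2 + u j ^+ 2 * v i ^+ 2
      - 2 * ((u i * v i) * (u j * v j)))).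
    by apply: eq_bigr => i _; apply: eq_bigr => j _; ring.
  under eq_bigr do rewrite sumrB big_split /= -!mulr_sumr -mulr_suml.
  rewrite sumrB big_split /= -!mulr_sumr -!mulr_suml.
  ring.
lra.
Qed.

Lemma sum_ffunS (R : realType) (T : finType) n (G : {ffun 'I_n.+1 -> T} -> R) :
  \sum_s G s = \sum_a \sum_(s : {ffun 'I_n -> T})
    G [ffun i => oapp s a (unlift ord0 i)].
Proof.
rewrite pair_big /=.
rewrite (reindex (fun q : T * {ffun 'I_n -> T} =>
  [ffun i => oapp q.2 q.1 (unlift ord0 i)])) //=.
exists (fun s : {ffun 'I_n.+1 -> T} => (s ord0, [ffun i => s (lift ord0 i)])).
  move=> [a s] _ /=; rewrite ffunE unlift_none /=; congr pair.
  by apply/ffunP => i; rewrite !ffunE liftK.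
move=> s _; apply/ffunP => i; rewrite !ffunE /=.
by case: unliftP => [j|] -> //=; rewrite ffunE.
Qed.

(** * Exponential moments and tails of sums of independent centred vectors *)

Section Concentration.
Variables (R : realType) (J T : finType) (b : R).
Hypothesis b0 : 0 <= b.

(* Adding one centred summand replaces 1 / c by 1 / (c - 8 b): the linear term of
   [expR_le_add_sqr] averages out, and Cauchy-Schwarz bounds the quadratic one. *)
Lemma exp_moment_step (p : T -> R) (Y : T -> J -> R) (v : J -> R) (c : R) :
  (forall a, 0 <= p a) -> \sum_a p a = 1 ->
  (forall a, \sum_j Y a j ^+ 2 <= b) -> (forall j, \sum_a p a * Y a j = 0) ->
  8 * b < c ->
  \sum_a p a * expR ((\sum_j (Y a j + v j) ^+ 2) / c) <=
  expR (b / c) * expR ((\sum_j v j ^+ 2) / (c - 8 * b)).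
Proof.
move=> p0 p1 Yb Y0 cb.
have c0 : 0 < c by move: b0 cb; lra.
set V := \sum_j v j ^+ 2.
have V0 : 0 <= V by apply: sumr_ge0 => j _; apply: sqr_ge0.
pose th a := \sum_j Y a j * v j.
(* [E] bounds the exponential without its cross term [2 * th a / c]; [expR_le_add_sqr] is applied to
   that cross term. *)
pose E := expR ((V + b) / c).
apply: (@le_trans _ _
   (\sum_a (p a * th a * (E * (2 / c)) + p a * (E * expR (8 * b * V / c ^+ 2))))).
  apply: ler_sum => a _.
  rewrite -[X in _ <= X + _]mulrA -mulrDr; apply: ler_wpM2l => //.
  have -> : \sum_j (Y a j + v j) ^+ 2 = V + \sum_j Y a j ^+ 2 + 2 * th a.
    rewrite /th mulr_sumr -!big_split /=; apply: eq_bigr => j _; ring.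
  apply: (@le_trans _ _ (E * expR (2 * th a / c))).
    rewrite -expRD ler_expR -mulrDl ler_pM2r ?invr_gt0 //.
    by have := Yb a; lra.
  rewrite mulrCA -mulrDr ler_wpM2l ?expR_ge0 //.
  apply: (le_trans (expR_le_add_sqr _)).
  have -> : 2 * th a / c = th a * (2 / c) by ring.
  rewrite lerD2l ler_expR.
  have -> : 2 * (th a * (2 / c)) ^+ 2 = (8 * th a ^+ 2) / c ^+ 2.
    by field; rewrite gt_eqF.
  rewrite ler_wpM2r ?invr_ge0 ?sqr_ge0 // -mulrA ler_pM2l //.
  apply: (le_trans (cauchy_schwarz_sum _ _)).
  exact: ler_wpM2r.
rewrite big_split /= -!mulr_suml p1 mul1r.
have -> : \sum_a p a * th a = 0.
  rewrite /th; under eq_bigr do rewrite mulr_sumr.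
  rewrite exchange_big big1 //= => j _.
  under eq_bigr do rewrite mulrA.
  by rewrite -mulr_suml Y0 mul0r.
rewrite mul0r add0r -!expRD ler_expR mulrDl [V / c + _]addrC -addrA lerD2l.
have cb0 : 0 < c - 8 * b by lra.
rewrite ler_pdivlMr //.
(* With [u = 8 * b / c] this is [(1 + u) * (1 - u) <= 1]. *)
have -> : (V / c + 8 * b * V / c ^+ 2) * (c - 8 * b) = V - V * (8 * b / c) ^+ 2.
  by field; rewrite gt_eqF.
by rewrite gerBl mulr_ge0 ?sqr_ge0.
Qed.

(** Induction on [N]: integrating out one summand lowers [c] by [8 * b] and costs a factor
    [expR (b / c)]. As [c] only decreases, each such factor is at most the one at the final value
    [c - 8 * b * N%:R]. *)
Lemma exp_moment_sum N (p : 'I_N -> T -> R) (Y : 'I_N -> T -> J -> R) (c : R) :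
  (forall k a, 0 <= p k a) -> (forall k, \sum_a p k a = 1) ->
  (forall k a, \sum_j Y k a j ^+ 2 <= b) ->
  (forall k j, \sum_a p k a * Y k a j = 0) ->
  8 * b * N%:R < c ->
  \sum_(s : {ffun 'I_N -> T}) (\prod_k p k (s k)) *
     expR ((\sum_j (\sum_k Y k (s k) j) ^+ 2) / c)
  <= expR (N%:R * b / (c - 8 * b * N%:R)).
Proof.
elim: N p Y c => [|N IH] p Y c p0 p1 Yb Y0 cb.
  (* [T] may be empty, so the only function on ['I_0] gets its values from the contradiction
     [i < 0]. *)
  rewrite (big_pred1 [ffun i : 'I_0 => False_rect T (Bool.diff_false_true (ltn_ord i))]).
    rewrite big_ord0 mul0r mul0r.
    rewrite big1 ?mul0r ?expR0 ?mulr1 // => j _.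
    by rewrite big_ord0 expr0n.
  by move=> s; apply/esym/eqP/ffunP => -[].
rewrite sum_ffunS exchange_big /=.
have bN : 0 <= b * N%:R by rewrite mulr_ge0.
have cb' : 8 * b < c by move: cb bN; rewrite -(natr1 N); lra.
have cb2 : 8 * b * N%:R < c - 8 * b by move: cb; rewrite -(natr1 N); lra.
apply: (@le_trans _ _ (\sum_(s : {ffun 'I_N -> T})
   (\prod_k p (lift ord0 k) (s k)) *
   (expR (b / c) * expR ((\sum_j (\sum_k Y (lift ord0 k) (s k) j) ^+ 2)
       / (c - 8 * b))))).
  apply: ler_sum => s _.
  under eq_bigr => a _.
    rewrite big_ord_recl ffunE unlift_none /= [p _ a * _]mulrC.
    under eq_bigr do rewrite ffunE liftK /=.
    under [in expR _]eq_bigr => j _.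
      rewrite big_ord_recl ffunE unlift_none /=.
      under eq_bigr do rewrite ffunE liftK /=.
      over.
    rewrite -mulrA.
    over.
  rewrite -mulr_sumr ler_wpM2l ?prodr_ge0 //.
  exact: exp_moment_step.
under eq_bigr do rewrite mulrCA.
rewrite -mulr_sumr.
have := IH (fun k => p (lift ord0 k)) (fun k => Y (lift ord0 k)) (c - 8 * b)
   (fun k => p0 _) (fun k => p1 _) (fun k => Yb _) (fun k => Y0 _) cb2.
move=> /(ler_wpM2l (expR_ge0 (b / c))) /le_trans; apply.
rewrite -expRD ler_expR -(natr1 N).
have -> : c - 8 * b * (N%:R + 1) = c - 8 * b - 8 * b * N%:R by ring.
rewrite [(_ + 1) * b]mulrDl mul1r mulrDl addrC lerD2l ler_wpM2l //.
rewrite lef_pV2 ?posrE; move: b0 cb2; lra.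
Qed.

(** Markov's inequality for the exponential moment at [c = 16 * b * N%:R], twice the critical value;
    that moment is at most [expR (1 / 8)]. *)
Lemma norm_sum_tail N (p : 'I_N -> T -> R) (Y : 'I_N -> T -> J -> R) (t : R) :
  (0 < N)%N -> 0 < b ->
  (forall k a, 0 <= p k a) -> (forall k, \sum_a p k a = 1) ->
  (forall k a, \sum_j Y k a j ^+ 2 <= b) ->
  (forall k j, \sum_a p k a * Y k a j = 0) ->
  \sum_(s : {ffun 'I_N -> T} | t <= \sum_j (\sum_k Y k (s k) j) ^+ 2)
     \prod_k p k (s k) <= expR (1 - t / (16 * b * N%:R)).
Proof.
move=> N0 bp p0 p1 Yb Y0.
have N0' : 0 < N%:R :> R by rewrite ltr0n.
have bN : 0 < b * N%:R by rewrite mulr_gt0.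
have cb : 8 * b * N%:R < 16 * b * N%:R by nra.
have c0 : 0 < 16 * b * N%:R by nra.
have M := exp_moment_sum p0 p1 Yb Y0 cb.
rewrite addrC expRD expRN ler_pdivlMl ?expR_gt0 // mulr_sumr.
apply: (@le_trans _ _ (expR (N%:R * b / (16 * b * N%:R - 8 * b * N%:R)))); last first.
  rewrite ler_expR; apply: (@le_trans _ _ (1 / 8)); last by lra.
  rewrite le_eqVlt; apply/orP; left; apply/eqP; field; rewrite gt_eqF // subr_gt0 //.
apply: (le_trans _ M); rewrite big_mkcond /=; apply: ler_sum => s _.
have q0 : 0 <= \prod_k p k (s k) by apply: prodr_ge0.
case: ifP => [ts|_]; last by rewrite mulr_ge0 ?expR_ge0.
by rewrite mulrC ler_wpM2l // ler_expR ler_pM2r ?invr_gt0.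
Qed.

End Concentration.

(** * Frobenius norm, trace norm and density matrices *)

Section Frobenius.
Import ComplexField.Normc.
Local Open Scope sesquilinear_scope.
Variable R : realType.
Local Notation C := R[i].
Local Notation toC := (real_complex R).

(** Flattening into real and imaginary parts makes a complex matrix a real vector, as the
    concentration bounds require. *)
Definition coord m (A : 'M[C]_m) (j : 'I_m * 'I_m * bool) : R :=
  if j.2 then complex.Re (A j.1.1 j.1.2) else complex.Im (A j.1.1 j.1.2).

Definition frob2 m (A : 'M[C]_m) : R := \sum_j coord A j ^+ 2.

Lemma coordB m (A B : 'M[C]_m) j : coord (A - B) j = coord A j - coord B j.
Proof.
by rewrite /coord !mxE; case: j.2; case: (A _ _) => ? ?; case: (B _ _) => ? ?.
Qed.

Lemma coordZ m (a : R) (A : 'M[C]_m) j : coord (toC a *: A) j = a * coord A j.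
Proof.
rewrite /coord !mxE; case: (A _ _) => x y; case: j.2 => /=.
  by rewrite mul0r subr0.
by rewrite mul0r addr0.
Qed.

Lemma coord_sum m (I : finType) (F : I -> 'M[C]_m) j :
  coord (\sum_i F i) j = \sum_i coord (F i) j.
Proof.
apply: (big_morph (fun A => coord A j)) => [A B|].
  by rewrite /coord !mxE; case: j.2; case: (A _ _) => ? ?; case: (B _ _) => ? ?.
by rewrite /coord !mxE; case: j.2.
Qed.

Lemma frob2_sumE m (A : 'M[C]_m) :
  frob2 A = \sum_x \sum_y (complex.Re (A x y) ^+ 2 + complex.Im (A x y) ^+ 2).
Proof.
rewrite /frob2 pair_big /= -(pair_big predT predT
  (fun (p : 'I_m * 'I_m) (c : bool) => coord A (p, c) ^+ 2)) /=.
by apply: eq_bigr => -[x y] _; rewrite big_bool.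
Qed.

Lemma frob2E m (A : 'M[C]_m) : toC (frob2 A) = \sum_x \sum_y `|A x y| ^+ 2.
Proof.
rewrite frob2_sumE rmorph_sum; apply: eq_bigr => x _.
rewrite rmorph_sum; apply: eq_bigr => y _.
by rewrite -add_Re2_Im2.
Qed.

Lemma frob2_normc m (A : 'M[C]_m) : frob2 A = \sum_x \sum_y normc (A x y) ^+ 2.
Proof.
rewrite frob2_sumE; apply: eq_bigr => x _; apply: eq_bigr => y _.
by case: (A x y) => a b /=; rewrite sqr_sqrtr // addr_ge0 ?sqr_ge0.
Qed.

Lemma frob2_trmx m (A : 'M[C]_m) : \tr (A^t* *m A) = toC (frob2 A).
Proof.
rewrite frob2E exchange_big /=; apply: eq_bigr => x _; rewrite mxE.
by apply: eq_bigr => y _; rewrite !mxE normCK mulrC.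
Qed.

Lemma frob2B_le m (A B D : 'M[C]_m) :
  frob2 (A - D) <= 2 * (frob2 (A - B) + frob2 (B - D)).
Proof.
rewrite /frob2 -big_split /= mulr_sumr; apply: ler_sum => j _.
rewrite !coordB.
have := sqr_ge0 ((coord A j - coord B j) - (coord B j - coord D j)); nra.
Qed.

Lemma frob2N m (A : 'M[C]_m) : frob2 (- A) = frob2 A.
Proof.
rewrite /frob2; apply: eq_bigr => j _.
rewrite /coord !mxE; case: j.2; case: (A _ _) => a b /=; exact: sqrrN.
Qed.

Lemma frob2M_le m (A B : 'M[C]_m) : frob2 (A *m B) <= frob2 A * frob2 B.
Proof.
rewrite !frob2_normc [X in _ <= _ * X]exchange_big mulr_suml.
apply: ler_sum => x _; rewrite mulr_sumr; apply: ler_sum => y _.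
apply: le_trans (cauchy_schwarz_sum _ _).
rewrite !expr2 -!expr2 ler_sqr ?nnegrE; last 2 first.
- by case: (_ x y) => a b /=; rewrite sqrtr_ge0.
- apply: sumr_ge0 => z _; rewrite mulr_ge0 //.
    by case: (A _ _) => a b /=; rewrite sqrtr_ge0.
  by case: (B _ _) => a b /=; rewrite sqrtr_ge0.
rewrite mxE; elim/big_ind2: _ => //.
- by rewrite normc0.
- by move=> a a' b b' h h'; apply: (le_trans (le_normcD _ _)); apply: lerD.
- by move=> z _; rewrite normcM.
Qed.

Lemma psdmx_gram m (A : 'M[C]_m) : psdmx (A^t* *m A).
Proof.
split; first by rewrite hermsymmxE trmx_mul map_mxM trmxCK.
move=> v; rewrite mulmxA -mulmxA -map_mxM -trmx_mul mxE sumr_ge0 // => i _.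
by rewrite !mxE mulrC mul_conjC_ge0.
Qed.

(** The trace norm sums the [m] diagonal entries of [S], the square root of [A^t* *m A];
    Cauchy-Schwarz against the all-ones vector bounds it by the Frobenius norm of [S], which equals
    that of [A]. *)
Lemma tracenorm_le_frob m (A : 'M[C]_m) : tracenorm A ^+ 2 <= m%:R * frob2 A.
Proof.
rewrite /tracenorm; have [[hS _] SS] := sqrtmx_spec (psdmx_gram A).
set S := sqrtmx _ in hS SS *.
have -> : frob2 A = frob2 S.
  apply: (@complexI R); rewrite -!frob2_trmx.
  by move: hS; rewrite hermsymmxE => /eqP <-; rewrite SS.
rewrite /mxtrace.
have -> : complex.Re (\sum_i S i i) = \sum_(i < m) 1 * complex.Re (S i i).
  under [RHS]eq_bigr do rewrite mul1r.
  by apply: (big_morph (@complex.Re R)) => // -[? ?] [? ?].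
apply: (le_trans (cauchy_schwarz_sum _ _)).
under eq_bigr do rewrite expr1n.
rewrite sumr_const card_ord ler_wpM2l // frob2_sumE; apply: ler_sum => x _.
rewrite (bigD1 x) //= -addrA lerDl addr_ge0 ?sqr_ge0 // sumr_ge0 // => y _.
by rewrite addr_ge0 ?sqr_ge0.
Qed.

(* rho is the square of sqrtmx rho, whose squared Frobenius norm is tr rho. *)
Lemma frob2_density m (rho : 'M[C]_m) : density rho -> frob2 rho <= 1.
Proof.
move=> [/sqrtmx_spec[[hS _] SS] tr1]; rewrite -SS.
have S1 : frob2 (sqrtmx rho) = 1.
  apply: (@complexI R); rewrite -frob2_trmx.
  by move: hS; rewrite hermsymmxE => /eqP <-; rewrite SS tr1.
by apply: (le_trans (frob2M_le _ _)); rewrite S1 mulr1.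
Qed.

Lemma density_mixed m : density (m.+1%:R^-1 *: 1%:M : 'M[C]_m.+1).
Proof.
split; last by rewrite mxtraceZ mxtrace1 mulVf // pnatr_eq0.
have cM : (m.+1%:R^-1 : C)^* = m.+1%:R^-1 by rewrite fmorphV rmorph_nat.
split.
  rewrite hermsymmxE; apply/eqP/matrixP => x y.
  by rewrite !mxE rmorphM /= cM rmorph_nat eq_sym.
move=> v; rewrite -scalemxAr mulmx1 -scalemxAl mxE mulr_ge0 ?invr_ge0 ?ler0n //.
rewrite mxE sumr_ge0 // => i _.
by rewrite !mxE mulrC mul_conjC_ge0.
Qed.

End Frobenius.

(** * Pauli measurements and their classical shadows *)

Section PauliShadows.
Local Open Scope sesquilinear_scope.
Variable R : realType.
Local Notation C := R[i].
Local Notation toC := (real_complex R).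

Definition pauli_of (t : 'I_3) : pauli :=
  match val t with 0 => PauliX | 1 => PauliY | _ => PauliZ end.

(** Averaging the three Pauli measurements sends [X] to [(X + tr X) / 3]; this is the inverse of
    that map, applied to the observed projector. *)
Definition qshadow (P : pauli) (b : bool) : 'M[C]_2 :=
  3 *: pauli_proj R P b - 1%:M.

Definition shadow n (P : 'I_n -> pauli) (s : {ffun 'I_n -> bool}) : 'M[C]_(qdim n) :=
  tensor (fun i => qshadow (P i) (s i)).

Lemma mul_ii : 'i * 'i = -1 :> C.
Proof. by rewrite -expr2 sqrCi. Qed.

Lemma conj_imag : ('i : C)^* = - 'i.
Proof. exact: conjCi. Qed.

Lemma ord2_ind (P : 'I_2 -> Prop) : P 0 -> P 1 -> forall x, P x.
Proof.
move=> P0 P1 x; have [->//|x1] := eqVneq x 0.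
suff -> : x = 1 by [].
by apply/val_inj; case: x x1 => [[|[|]]].
Qed.

Definition proj_weight (P : pauli) : R := if P is PauliZ then 1 else 2^-1.

Definition proj_vec (P : pauli) (b : bool) (x : 'I_2) : C :=
  match P with
  | PauliX => if x == 0 then 1 else (-1) ^+ b
  | PauliY => if x == 0 then 1 else (-1) ^+ b * 'i
  | PauliZ => (x == b :> nat)%:R
  end.

Lemma pauli_proj_entry P b x y :
  pauli_proj R P b x y = 2^-1 * ((x == y)%:R + (-1) ^+ b * pauli_mx R P x y).
Proof. by rewrite mxE [X in _ * X]mxE [X in X + _]mxE [X in _ + X]mxE. Qed.

(* The projectors have rank one; the weights avoid the square roots that
   normalized eigenvectors would need. *)
Lemma pauli_projE P b x y :
  pauli_proj R P b x y = toC (proj_weight P) * (proj_vec P b x * (proj_vec P b y)^*).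
Proof.
have h : toC 2^-1 = 2^-1 by rewrite fmorphV rmorph_nat.
have I2 := mul_ii.
rewrite /pauli_proj !mxE /proj_weight /proj_vec.
case: P; rewrite ?h ?rmorph1; move: x y; apply: ord2_ind; apply: ord2_ind; case: b => /=;
  rewrite ?(expr0,expr1,rmorphM,rmorphN,rmorph1,rmorph0,conj_imag) /= ?conj_imag; by field: I2.
Qed.

(** The Pauli expansion of the swap operator on two qubits, read entrywise. *)
Lemma pauli_swap (u v x y : 'I_2) :
  (v == u)%:R * (x == y)%:R + pauli_mx R PauliX v u * pauli_mx R PauliX x y
  + pauli_mx R PauliY v u * pauli_mx R PauliY x y
  + pauli_mx R PauliZ v u * pauli_mx R PauliZ x y
  = 2 * ((u == x) && (v == y))%:R.
Proof.
have I2 := mul_ii.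
rewrite !mxE; move: u v x y.
do 4 apply: ord2_ind; rewrite ?eqxx /= ?(expr0, expr1); ring: I2.
Qed.

(** Terms linear in the sign [(-1) ^+ b] cancel between the two outcomes. *)
Lemma qshadow_sum (P : pauli) (u v x y : 'I_2) :
  \sum_b pauli_proj R P b v u * qshadow P b x y
  = 2^-1 * ((v == u)%:R * (x == y)%:R + 3 * (pauli_mx R P v u * pauli_mx R P x y)).
Proof.
have e b z t : qshadow P b z t = 3 * pauli_proj R P b z t - (z == t)%:R.
  by rewrite mxE [X in X + _]mxE [X in _ + X]mxE [X in - X]mxE.
have -> : \sum_b pauli_proj R P b v u * qshadow P b x y =
  \sum_(b : bool) (2^-1 * ((v == u)%:R + (-1) ^+ b * pauli_mx R P v u)) *
    (3 * (2^-1 * ((x == y)%:R + (-1) ^+ b * pauli_mx R P x y)) - (x == y)%:R).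
  by apply: eq_bigr => b _; rewrite e (pauli_proj_entry P b v u) (pauli_proj_entry P b x y).
move: (pauli_mx _ _ _ _) (pauli_mx _ _ _ _) => p q.
rewrite big_bool expr0 expr1 /=.
by field.
Qed.

(** The identity term occurs once for each of three bases, and each Pauli term once with factor 3.
    All four thus have equal weight and form the swap of [pauli_swap]. *)
Lemma qshadow_design (u v x y : 'I_2) :
  \sum_(t : 'I_3) \sum_b pauli_proj R (pauli_of t) b v u * qshadow (pauli_of t) b x y
  = 3 * ((u == x) && (v == y))%:R.
Proof.
under eq_bigr do rewrite qshadow_sum.
rewrite !big_ord_recl big_ord0 /pauli_of /=.
have -> : ((u == x) && (v == y))%:R = 2^-1 * (2 * ((u == x) && (v == y))%:R) :> C by field.
rewrite -pauli_swap.
move: (pauli_mx R PauliX _ _) (pauli_mx R PauliX _ _) (pauli_mx R PauliY _ _)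
 (pauli_mx R PauliY _ _) (pauli_mx R PauliZ _ _) (pauli_mx R PauliZ _ _) => *.
by field.
Qed.

Lemma qshadow_frob P b : \sum_x \sum_y `|qshadow P b x y| ^+ 2 = 5.
Proof.
have I2 := mul_ii.
have c2 : (2^-1 : C)^* = 2^-1 by rewrite fmorphV rmorph_nat.
rewrite !big_ord_recl !big_ord0 !normCK /qshadow /pauli_proj !mxE /=.
case: P; case: b => /=;
  rewrite ?(rmorphM,rmorphN,rmorphD,rmorph1,rmorph0,rmorph_nat,conj_imag,c2) /=
    ?(conj_imag,c2,rmorph1,rmorph0); by field: I2.
Qed.

Lemma sum_qubits (V : nmodType) n (F : {ffun 'I_n -> 'I_2} -> V) :
  \sum_(x < qdim n) F (qubits x) = \sum_f F f.
Proof. by rewrite -(big_enum_val F). Qed.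

Lemma forall_qubits_eq n (x y : 'I_(qdim n)) :
  [forall i, qubits x i == qubits y i] = (x == y).
Proof.
apply/forallP/eqP => [e|-> //]; apply: enum_val_inj.
by apply/ffunP => i; apply/eqP/e.
Qed.

Lemma prod_natr_bool (I : finType) (p : pred I) : \prod_i (p i)%:R = [forall i, p i]%:R :> C.
Proof.
case: forallP => [h|h]; first by rewrite big1 // => i _; rewrite h.
have [i /negPf ni] : exists i, ~~ p i.
  by apply/existsP; rewrite -negb_forall; apply/forallP.
by rewrite (bigD1 i) //= ni mul0r.
Qed.

Lemma tensor_frob n (A : 'I_n -> 'M[C]_2) :
  toC (frob2 (tensor A)) = \prod_i \sum_x \sum_y `|A i x y| ^+ 2.
Proof.
rewrite frob2E bigA_distr_bigA /= -[RHS]sum_qubits; apply: eq_bigr => x _.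
rewrite bigA_distr_bigA /= -[RHS]sum_qubits; apply: eq_bigr => y _.
by rewrite mxE normr_prod prodrXl.
Qed.

Lemma shadow_frob n (P : 'I_n -> pauli) s : frob2 (shadow P s) = 5 ^+ n.
Proof.
apply: (@complexI R); rewrite tensor_frob.
under eq_bigr do rewrite qshadow_frob.
by rewrite prodr_const card_ord rmorphXn rmorph_nat.
Qed.

(** A tensor product of rank-one projectors is a nonnegative multiple of [W *m W^t*], so the trace
    is a multiple of the quadratic form of [rho] at [W]. *)
Lemma outcome_trace n (rho : 'M[C]_(qdim n)) (P : 'I_n -> pauli) s : density rho ->
  0 <= \tr (rho *m tensor (fun i => pauli_proj R (P i) (s i))).
Proof.
move=> [[_ pos] _].
pose W : 'cV[C]_(qdim n) := \col_x \prod_i proj_vec (P i) (s i) (qubits x i).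
pose w := \prod_i proj_weight (P i).
have -> : \tr (rho *m tensor (fun i => pauli_proj R (P i) (s i))) =
    toC w * (W^t* *m rho *m W) 0 0.
  rewrite -mulmxA mxE mulr_sumr; apply: eq_bigr => x _.
  rewrite [LHS]mxE [(_ *m W) _ _]mxE !mulr_sumr; apply: eq_bigr => y _.
  rewrite [tensor _ _ _]mxE [(W^t* ) _ _]mxE [W^T _ _]mxE ![W _ _]mxE.
  rewrite (eq_bigr _ (fun i _ => pauli_projE (P i) (s i) (qubits y i) (qubits x i))).
  rewrite !big_split /= -!rmorph_prod /w; ring.
rewrite mulr_ge0 // ler0c prodr_ge0 // => i _.
by case: (P i) => /=; rewrite ?invr_ge0.
Qed.

Lemma outcome_probE n (rho : 'M[C]_(qdim n)) (P : 'I_n -> pauli) s : density rho ->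
  toC (outcome_prob rho P s) =
  \tr (rho *m tensor (fun i => pauli_proj R (P i) (s i))).
Proof. by move=> /(outcome_trace P s) /ger0_real /RRe_real. Qed.

Lemma outcome_prob_ge0 n (rho : 'M[C]_(qdim n)) (P : 'I_n -> pauli) s :
  density rho -> 0 <= outcome_prob rho P s.
Proof. by move=> dr; rewrite -ler0c outcome_probE // outcome_trace. Qed.

Lemma sum_pauli_proj P x y : \sum_b pauli_proj R P b x y = (x == y)%:R.
Proof.
under eq_bigr do rewrite pauli_proj_entry.
by rewrite big_bool expr0 expr1 /=; field.
Qed.

Lemma outcome_prob_sum n (rho : 'M[C]_(qdim n)) (P : 'I_n -> pauli) :
  density rho -> \sum_s outcome_prob rho P s = 1.
Proof.
move=> dr; apply: (@complexI R); rewrite rmorph_sum rmorph1.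
rewrite (eq_bigr _ (fun s _ => outcome_probE P s dr)).
rewrite -raddf_sum -mulmx_sumr.
have -> : \sum_(s : {ffun 'I_n -> bool}) tensor (fun i => pauli_proj R (P i) (s i))
    = 1%:M.
  apply/matrixP => x y; rewrite summxE.
  under eq_bigr do rewrite mxE.
  rewrite -(bigA_distr_bigA (fun i b => pauli_proj R (P i) b (qubits x i) (qubits y i))).
  under eq_bigr do rewrite sum_pauli_proj.
  by rewrite prod_natr_bool forall_qubits_eq mxE.
by rewrite mulmx1; case: dr.
Qed.

(** The coefficient of each entry [rho u v] factors over the qubits, and [qshadow_design] evaluates
    each factor; [3 ^+ n] is the number of settings. *)
Lemma shadow_design n (rho : 'M[C]_(qdim n)) : density rho ->
  \sum_(t : {ffun 'I_n -> 'I_3}) \sum_s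
     toC (outcome_prob rho (fun i => pauli_of (t i)) s) *:
       shadow (fun i => pauli_of (t i)) s
  = 3 ^+ n *: rho.
Proof.
move=> dr; apply/matrixP => x y; rewrite summxE.
pose G (t : {ffun 'I_n -> 'I_3}) (s : {ffun 'I_n -> bool}) u v :=
  \prod_i (pauli_proj R (pauli_of (t i)) (s i) (qubits v i) (qubits u i) *
           qshadow (pauli_of (t i)) (s i) (qubits x i) (qubits y i)).
transitivity (\sum_u \sum_v rho u v * \sum_t \sum_s G t s u v).
  under [RHS]eq_bigr => u _ do under eq_bigr => v _ do rewrite mulr_sumr.
  under [RHS]eq_bigr do rewrite exchange_big /=.
  rewrite exchange_big /=; apply: eq_bigr => t _; rewrite summxE.
  under [RHS]eq_bigr => u _ do under eq_bigr => v _ do rewrite mulr_sumr.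
  under [RHS]eq_bigr do rewrite exchange_big /=.
  rewrite exchange_big /=; apply: eq_bigr => s _.
  rewrite mxE outcome_probE // /mxtrace mulr_suml; apply: eq_bigr => u _.
  rewrite mxE mulr_suml; apply: eq_bigr => v _.
  by rewrite !mxE /G big_split /= mulrA.
(* Distributivity is used twice: first over the outcomes of each qubit, then over its bases. *)
have Gsum u v : \sum_t \sum_s G t s u v = 3 ^+ n * ((u == x) && (v == y))%:R.
  under eq_bigr => t _ do rewrite /G -(bigA_distr_bigA (fun i b =>
    pauli_proj R (pauli_of (t i)) b (qubits v i) (qubits u i) *
           qshadow (pauli_of (t i)) b (qubits x i) (qubits y i))).
  rewrite -(bigA_distr_bigA (fun i t => \sum_b
    pauli_proj R (pauli_of t) b (qubits v i) (qubits u i) *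
           qshadow (pauli_of t) b (qubits x i) (qubits y i))).
  under eq_bigr do rewrite qshadow_design.
  rewrite big_split /= prodr_const card_ord prod_natr_bool; congr (_ * _%:R).
  rewrite -!forall_qubits_eq; congr nat_of_bool.
  apply/forallP/andP => [h|[/forallP h /forallP h'] i]; last by rewrite h h'.
  by split; apply/forallP => i; case/andP: (h i).
rewrite (bigD1 x) //= (bigD1 y) //= Gsum !eqxx mulr1 mxE.
rewrite big1 => [|v /negPf vy]; last by rewrite Gsum vy andbF !mulr0.
rewrite big1 => [|u /negPf ux]; first by rewrite !addr0 mulrC.
by rewrite big1 // => v _; rewrite Gsum ux !mulr0.
Qed.

End PauliShadows.

(** * Tail bound for sums that are not centred *)

(** By Jensen the mean also has squared norm at most [b], so centring raises the bound to [4 * b]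
    and the constant 16 of [norm_sum_tail] to 64. *)
Lemma centered_sum_tail (R : realType) (J T : finType) (b : R) N (p : 'I_N -> T -> R)
    (X : 'I_N -> T -> J -> R) (t : R) :
  (0 < N)%N -> 0 < b ->
  (forall k a, 0 <= p k a) -> (forall k, \sum_a p k a = 1) ->
  (forall k a, \sum_j X k a j ^+ 2 <= b) ->
  \sum_(s : {ffun 'I_N -> T} |
        t <= \sum_j (\sum_k X k (s k) j - \sum_k \sum_a p k a * X k a j) ^+ 2)
     \prod_k p k (s k) <= expR (1 - t / (64 * b * N%:R)).
Proof.
move=> N0 b0 p0 p1 Xb.
pose m k j := \sum_a p k a * X k a j.
have jensen k j : m k j ^+ 2 <= \sum_a p k a * X k a j ^+ 2.
  have : 0 <= \sum_a p k a * (X k a j - m k j) ^+ 2.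
    by apply: sumr_ge0 => a _; rewrite mulr_ge0 ?sqr_ge0.
  have -> : \sum_a p k a * (X k a j - m k j) ^+ 2 =
      \sum_a (p k a * X k a j ^+ 2 - p k a * X k a j * (2 * m k j) + p k a * m k j ^+ 2).
    by apply: eq_bigr => a _; ring.
  rewrite big_split sumrB /= -!mulr_suml p1 -/(m k j); lra.
have mb k : \sum_j m k j ^+ 2 <= b.
  apply: (@le_trans _ _ (\sum_j \sum_a p k a * X k a j ^+ 2)); first exact: ler_sum.
  rewrite exchange_big /=; under eq_bigr do rewrite -mulr_sumr.
  apply: (@le_trans _ _ (\sum_a p k a * b)); last by rewrite -mulr_suml p1 mul1r.
  by apply: ler_sum => a _; rewrite ler_wpM2l.
have Yb k a : \sum_j (X k a j - m k j) ^+ 2 <= 4 * b.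
  apply: (@le_trans _ _ (2 * (\sum_j X k a j ^+ 2) + 2 * \sum_j m k j ^+ 2)); last first.
    by have := Xb k a; have := mb k; lra.
  rewrite !mulr_sumr -big_split /=; apply: ler_sum => j _.
  by have := sqr_ge0 (X k a j + m k j); lra.
have Y0 k j : \sum_a p k a * (X k a j - m k j) = 0.
  under eq_bigr do rewrite mulrBr.
  by rewrite sumrB -mulr_suml p1 mul1r subrr.
have b40 : 0 < 4 * b by lra.
have := norm_sum_tail (ltW b40) t N0 b40 p0 p1 Yb Y0.
have -> : 16 * (4 * b) * N%:R = 64 * b * N%:R by ring.
apply: le_trans; rewrite le_eqVlt; apply/orP; left; apply/eqP; apply: eq_bigl => s.
by congr (_ <= _); apply: eq_bigr => j _; rewrite sumrB.
Qed.

(** * The tomography scheme and its number of copies *)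

Section Scheme.
Variable R : realType.
Local Notation C := R[i].
Local Notation toC := (real_complex R).

Definition shadow_mean n N (P : 'I_N -> 'I_n -> pauli)
    (s : {ffun 'I_N -> {ffun 'I_n -> bool}}) : 'M[C]_(qdim n) :=
  toC N%:R^-1 *: \sum_k shadow R (P k) (s k).

Lemma sum_prod_outcome_prob n N (P : 'I_N -> 'I_n -> pauli) (rho : 'M[C]_(qdim n)) :
  density rho -> \sum_(s : {ffun 'I_N -> {ffun 'I_n -> bool}})
    \prod_k outcome_prob rho (P k) (s k) = 1.
Proof.
move=> dr; rewrite -(bigA_distr_bigA (fun k a => outcome_prob rho (P k) a)).
by rewrite big1 // => k _; rewrite outcome_prob_sum.
Qed.

(** A shadow in a fixed setting need not have mean [rho]; only the sum of the means over all copies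
    is required to match, so the settings can be deterministic. *)
Lemma shadow_mean_near n N (P : 'I_N -> 'I_n -> pauli) (rho : 'M[C]_(qdim n)) (t : R) :
  (0 < N)%N -> density rho ->
  \sum_k \sum_s toC (outcome_prob rho (P k) s) *: shadow R (P k) s = toC N%:R *: rho ->
  1 - expR (1 - N%:R * t / (64 * 5 ^+ n)) <=
  \sum_(s : {ffun 'I_N -> {ffun 'I_n -> bool}} | frob2 (shadow_mean P s - rho) < t)
    \prod_k outcome_prob rho (P k) (s k).
Proof.
move=> N0 dr design.
have NR : 0 < N%:R :> R by rewrite ltr0n.
rewrite lerBlDr -[leLHS](sum_prod_outcome_prob P dr).
rewrite (bigID (fun s => frob2 (shadow_mean P s - rho) < t)) /= lerD2l.
have b0 : 0 < 5 ^+ n :> R by rewrite exprn_gt0.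
have Xb k a : \sum_j coord (shadow R (P k) a) j ^+ 2 <= 5 ^+ n.
  by rewrite -(shadow_frob R (P k) a).
have := centered_sum_tail (p := fun k => outcome_prob rho (P k))
  (X := fun k a j => coord (shadow R (P k) a) j) (N%:R ^+ 2 * t) N0 b0
  (fun k a => outcome_prob_ge0 (P k) a dr) (fun k => outcome_prob_sum (P k) dr) Xb.
have -> : N%:R ^+ 2 * t / (64 * 5 ^+ n * N%:R) = N%:R * t / (64 * 5 ^+ n).
  by field; rewrite !gt_eqF.
apply: le_trans; rewrite le_eqVlt; apply/orP; left; apply/eqP; apply: eq_bigl => s.
rewrite -leNgt -(ler_pM2l (exprn_gt0 2 NR)) /frob2 mulr_sumr.
congr (_ <= _); apply: eq_bigr => j _.
have -> : \sum_k \sum_a outcome_prob rho (P k) a * coord (shadow R (P k) a) j =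
    N%:R * coord rho j.
  rewrite -coordZ -design coord_sum; apply: eq_bigr => k _.
  by rewrite coord_sum; apply: eq_bigr => a _; rewrite coordZ.
rewrite coordB coordZ coord_sum -exprMn mulrBr mulrA divff ?mul1r //.
by rewrite gt_eqF.
Qed.

Lemma ex_density m : (0 < m)%N -> exists sigma : 'M[C]_m, density sigma.
Proof. by case: m => // m _; exists (m.+1%:R^-1 *: 1%:M); apply: density_mixed. Qed.

Lemma qdimE n : qdim n = (2 ^ n)%N.
Proof. by rewrite /qdim card_ffun !card_ord. Qed.

Lemma qdim_natr n : (qdim n)%:R = 2 ^+ n :> R.
Proof. by rewrite qdimE natrX. Qed.

Lemma tracenorm_lt m (A : 'M[C]_m) (eps : R) :
  0 < eps -> m%:R * frob2 A < eps ^+ 2 -> tracenorm A < eps.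
Proof.
move=> e0 h; rewrite ltNge; apply/negP => he.
have := le_lt_trans (tracenorm_le_frob A) h.
rewrite ltNge => /negP; apply.
by rewrite lerXn2r // nnegrE ?(le_trans _ he) // ltW.
Qed.

Lemma success_prob_ge n N (S : pauli_scheme R n N) (eps : R) rho
    (Q : pred {ffun 'I_N -> {ffun 'I_n -> bool}}) :
  density rho -> (forall s, Q s -> tracenorm (rho - output S s) < eps) ->
  \sum_(s | Q s) \prod_k outcome_prob rho (Defs.basis S k) (s k) <= success_prob S eps rho.
Proof.
move=> dr h; rewrite /success_prob big_mkcond [leRHS]big_mkcond /=.
apply: ler_sum => s _; case: ifP => [/h -> //|_].
by case: ifP => // _; apply: prodr_ge0 => k _; apply: outcome_prob_ge0.
Qed.

Lemma trivial_scheme n (eps delta : R) : 0 < eps -> 0 <= delta ->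
  4 * 2 ^+ n < eps ^+ 2 ->
  exists S : pauli_scheme R n 0, solves_tomography S eps delta.
Proof.
move=> e0 d0 he.
have [sigma ds] : exists sigma : 'M[C]_(qdim n), density sigma.
  by apply: ex_density; rewrite qdimE expn_gt0.
exists (PauliScheme (fun _ _ => PauliX) (fun=> ds)) => rho dr.
apply: (@le_trans _ _ 1); first lra.
rewrite -[leLHS](sum_prod_outcome_prob (fun (_ : 'I_0) _ => PauliX) dr).
apply: (success_prob_ge (S := PauliScheme _ _) (Q := xpredT)) => // s _ /=.
apply: tracenorm_lt => //; apply: le_lt_trans he.
rewrite mulrC qdim_natr ler_wpM2r ?exprn_ge0 //.
(* Passing through 0 gives the distance bound [2 * (1 + 1) = 4]. *)
apply: (le_trans (frob2B_le _ 0 _)); rewrite subr0 sub0r frob2N.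
by have := frob2_density ds; have := frob2_density dr; lra.
Qed.

Lemma pauli_scheme_of_design n N (P : 'I_N -> 'I_n -> pauli) (eps delta : R) :
  (0 < N)%N -> 0 < eps ->
  (forall rho : 'M[C]_(qdim n), density rho ->
  \sum_k \sum_s toC (outcome_prob rho (P k) s) *: shadow R (P k) s = toC N%:R *: rho) ->
  expR (1 - N%:R * eps ^+ 2 / (256 * 10 ^+ n)) <= delta ->
  exists S : pauli_scheme R n N, solves_tomography S eps delta.
Proof.
move=> N0 e0 design hd.
have [sigma ds] : exists sigma : 'M[C]_(qdim n), density sigma.
  by apply: ex_density; rewrite qdimE expn_gt0.
(* Two errors below [t] combine to less than [4 * t] by [frob2B_le], and the dimension [2 ^+ n]
   turns this into [eps ^+ 2]. *)
pose t := eps ^+ 2 / (4 * 2 ^+ n).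
have p2 : 0 < 2 ^+ n :> R by rewrite exprn_gt0.
have p5 : 0 < 5 ^+ n :> R by rewrite exprn_gt0.
pose near s := [set tau : 'M[C]_(qdim n) |
  density tau /\ frob2 (shadow_mean P s - tau) < t]%classic.
(* [sigma] is the default when no density matrix is near the mean; in the good event [rho] itself is
   near. *)
pose out s := xget sigma (near s).
have dout s : density (out s).
  by rewrite /out; case: xgetP => // tau -> [].
exists (PauliScheme P dout) => rho dr.
apply: (@le_trans _ _ (1 - expR (1 - N%:R * t / (64 * 5 ^+ n)))).
  rewrite lerD2l lerN2; apply: le_trans hd; rewrite ler_expR lerD2l lerN2.
  have -> : 10 ^+ n = 2 ^+ n * 5 ^+ n :> R by rewrite -exprMn; congr (_ ^+ _); ring.
  rewrite /t le_eqVlt; apply/orP; left; apply/eqP; field.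
  by rewrite !gt_eqF.
apply: (le_trans (shadow_mean_near t N0 dr (design _ dr))).
apply: (success_prob_ge (S := PauliScheme _ _)) => // s hs /=.
apply: tracenorm_lt => //.
have [_ ho] : near s (out s) by rewrite /out; apply: (xgetPex sigma); exists rho.
have := frob2B_le rho (shadow_mean P s) (out s).
rewrite -[rho - _ in X in _ <= X]opprB frob2N => h.
rewrite qdim_natr; have -> : eps ^+ 2 = 2 ^+ n * (4 * t) by rewrite /t; field; rewrite gt_eqF.
by rewrite ltr_pM2l //; lra.
Qed.

(** Enumerating pairs of a repetition and a setting uses each setting exactly [M] times. *)
Definition repeated_basis n M (k : 'I_#|{: 'I_M * {ffun 'I_n -> 'I_3}}|) (i : 'I_n) : pauli :=
  pauli_of ((enum_val k).2 i).

Lemma repeated_basis_design n M (rho : 'M[C]_(qdim n)) : density rho ->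
  \sum_k \sum_s toC (outcome_prob rho (@repeated_basis n M k) s) *:
      shadow R (@repeated_basis n M k) s =
  toC #|{: 'I_M * {ffun 'I_n -> 'I_3}}|%:R *: rho.
Proof.
move=> dr.
rewrite -(big_enum_val (fun q : 'I_M * {ffun 'I_n -> 'I_3} =>
  \sum_s toC (outcome_prob rho (fun i => pauli_of (q.2 i)) s) *:
      shadow R (fun i => pauli_of (q.2 i)) s)) /=.
rewrite -(pair_big predT predT (fun (_ : 'I_M) (q : {ffun 'I_n -> 'I_3}) =>
  \sum_s toC (outcome_prob rho (fun i => pauli_of (q i)) s) *:
      shadow R (fun i => pauli_of (q i)) s)) /=.
rewrite sumr_const shadow_design // card_prod card_ffun !card_ord.
by rewrite -scaler_nat scalerA -natrX -natrM rmorph_nat.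
Qed.

End Scheme.

(* log (1 / delta) is read for delta bounded away from 1: the bound below is
   literally 10 ^ n * log (1 / delta) / eps ^ 2 for delta <= 1 / 2, and the
   value at delta = 1 / 2 for larger delta *)
Theorem theorem1 (R : realType) :
  exists2 K : R, 0 < K &
    forall (n : nat) (eps delta : R), 0 < eps -> 0 < delta < 1 ->
      exists N : nat,
        N%:R <= K * (10 ^+ n * ln (1 / Num.min delta (1 / 2)) / eps ^+ 2) /\
        exists S : pauli_scheme R n N, solves_tomography S eps delta.
Proof.
(* [776 = 768 + 8]: [768 = 3 * 256] makes the exponent reach [3 * L], and 8 pays for rounding up. *)
exists 776; first by rewrite ltr0n.
move=> n eps delta e0 /andP[d0 d1].
set d := Num.min delta (1 / 2); set L := ln (1 / d).
have dp : 0 < d by rewrite lt_min d0; lra.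
have dle : d <= delta by rewrite ge_min lexx.
have Ld : expR (- L) = d by rewrite /L div1r lnV ?posrE // opprK lnK.
(* From [1 - L <= expR (- L) = d <= 1 / 2]. *)
have L2 : 1 / 2 <= L.
  have dh : d <= 1 / 2 by rewrite ge_min lexx orbT.
  by have := expR_ge1Dx (- L); rewrite Ld; lra.
have e2 : 0 < eps ^+ 2 by rewrite exprn_gt0.
have p2 : 0 < 2 ^+ n :> R by rewrite exprn_gt0.
have p3 : 0 < 3 ^+ n :> R by rewrite exprn_gt0.
have p5 : 0 < 5 ^+ n :> R by rewrite exprn_gt0.
have p10 : 10 ^+ n = 2 ^+ n * 5 ^+ n :> R by rewrite -exprMn; congr (_ ^+ _); ring.
have rate0 : 0 <= 10 ^+ n * L / eps ^+ 2.
  rewrite divr_ge0 ?(ltW e2) // mulr_ge0 ?exprn_ge0 ?ler0n //.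
  by apply: le_trans L2; rewrite divr_ge0.
have [he|he] := ltrP (4 * 2 ^+ n) (eps ^+ 2).
  exists 0; split; last exact: trivial_scheme (ltW d0) he.
  by rewrite mulr_ge0 ?ler0n ?rate0.
pose x := 768 * (10 ^+ n * L / eps ^+ 2) / 3 ^+ n.
have x0 : 0 <= x.
  by apply: divr_ge0 (mulr_ge0 (ler0n _ _) rate0) (ltW p3).
have /andP[xl xu] := truncn_itv x0.
(* The successor rounds [x] up and keeps the number of copies positive. *)
pose M := (Num.truncn x).+1.
have NE : #|{: 'I_M * {ffun 'I_n -> 'I_3}}|%:R = M%:R * 3 ^+ n :> R.
  by rewrite card_prod card_ffun !card_ord natrM natrX.
exists #|{: 'I_M * {ffun 'I_n -> 'I_3}}|; split.
  have h3 : 3 ^+ n <= 8 * (10 ^+ n * L / eps ^+ 2).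
    apply: (@le_trans _ _ (5 ^+ n)); first by rewrite lerXn2r ?nnegrE ?ler0n // ler_nat.
    rewrite mulrA ler_pdivlMr // p10.
    apply: (@le_trans _ _ (5 ^+ n * (4 * 2 ^+ n))); first by rewrite ler_wpM2l // ltW.
    have : 0 <= 2 ^+ n * 5 ^+ n * (L - 1 / 2) :> R.
      by rewrite !mulr_ge0 ?subr_ge0 // ltW.
    lra.
  have hM : M%:R <= x + 1 by rewrite -natr1 lerD2r.
  rewrite NE; apply: (le_trans (ler_wpM2r (ltW p3) hM)).
  have -> : (x + 1) * 3 ^+ n = 768 * (10 ^+ n * L / eps ^+ 2) + 3 ^+ n.
    by rewrite /x; field; rewrite !gt_eqF.
  lra.
apply: (pauli_scheme_of_design (P := @repeated_basis n M)) => //.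
- by rewrite card_prod card_ffun !card_ord muln_gt0 expn_gt0.
- exact: repeated_basis_design.
apply: le_trans dle; rewrite -Ld ler_expR NE.
(* Since [1 <= 2 * L], an exponent of [3 * L] absorbs the leading 1 and leaves [- L]. *)
have h : 3 * L <= M%:R * 3 ^+ n * eps ^+ 2 / (256 * 10 ^+ n).
  apply: (@le_trans _ _ (x * 3 ^+ n * eps ^+ 2 / (256 * 10 ^+ n))).
    rewrite le_eqVlt; apply/orP; left; apply/eqP; rewrite /x; field.
    by rewrite !gt_eqF ?exprn_gt0.
  rewrite ler_pM2r ?invr_gt0 ?mulr_gt0 ?exprn_gt0 ?ltr0n //.
  by rewrite !ler_wpM2r ?(ltW p3) ?(ltW e2) ?(ltW xu).
lra.
Qed.
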